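(* Let $n$ be a positive integer. The monoid $M_n(\mathbb{Z}_{\max})$ is finitely generated if and only if $n \le 2$.
   Context: $\mathbb{Z}_{\max} = \mathbb{Z}\cup\{-\infty\}$ is the tropical integer semiring, with semiring addition $\max$ and semiring multiplication the usual addition; its semiring zero is $-\infty$ and its semiring one is $0$. $M_n(\mathbb{Z}_{\max})$ is the monoid of all $n\times n$ matrices over $\mathbb{Z}_{\max}$ under (tropical) matrix multiplication. *)

(* Defs.v *)
From HB Require Import structures.
From mathcomp Require Import all_boot all_order all_algebra.

Set Implicit Arguments.
Unset Strict Implicit.
Unset Printing Implicit Defensive.

Import Order.TTheory GRing.Theory Num.Theory.

(* [None] is -oo and [Some a] is the integer a. *)
Definition Zmax : Type := option int.

HB.instance Definition _ := Choice.on Zmax.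

Definition Zmax_add (x y : Zmax) : Zmax :=
  match x, y with
  | Some a, Some b => Some (Num.max a b)
  | None, _ => y
  | _, None => x
  end.

Definition Zmax_mul (x y : Zmax) : Zmax :=
  match x, y with
  | Some a, Some b => Some (a + b)%R
  | _, _ => None
  end.

Fact Zmax_addA : associative Zmax_add.
Proof. by move=> [a|] [b|] [c|] //=; rewrite maxA. Qed.

Fact Zmax_addC : commutative Zmax_add.
Proof. by move=> [a|] [b|] //=; rewrite maxC. Qed.

Fact Zmax_add0 : left_id (None : Zmax) Zmax_add.
Proof. by []. Qed.

Fact Zmax_mulA : associative Zmax_mul.
Proof. by move=> [a|] [b|] [c|] //=; rewrite addrA. Qed.

Fact Zmax_mulC : commutative Zmax_mul.
Proof. by move=> [a|] [b|] //=; rewrite addrC. Qed.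

Fact Zmax_mul1 : left_id (Some 0%R : Zmax) Zmax_mul.
Proof. by move=> [a|] //=; rewrite add0r. Qed.

Fact Zmax_mulDl : left_distributive Zmax_mul Zmax_add.
Proof. by move=> [a|] [b|] [c|] //=; rewrite addr_maxl. Qed.

Fact Zmax_mul0 : left_zero (None : Zmax) Zmax_mul.
Proof. by []. Qed.

Fact Zmax_1neq0 : (Some 0%R : Zmax) != None.
Proof. by []. Qed.

HB.instance Definition _ :=
  GRing.isNmodule.Build Zmax Zmax_addA Zmax_addC Zmax_add0.

HB.instance Definition _ :=
  GRing.Nmodule_isComNzSemiRing.Build Zmax
    Zmax_mulA Zmax_mulC Zmax_mul1 Zmax_mulDl Zmax_mul0 Zmax_1neq0.

(* An alias of ['M[Zmax]_n], because MathComp does not equip matrices with a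
   [monoidType] structure. *)
Definition MZmax (n : nat) : Type := 'M[Zmax]_n.

HB.instance Definition _ (n : nat) := Choice.on (MZmax n).

HB.instance Definition _ (n : nat) :=
  isMonoid.Build (MZmax n) (@mulmxA Zmax n n n n) (@mul1mx Zmax n n)
    (@mulmx1 Zmax n n).

Definition finitely_generated (G : monoidType) : Prop :=
  exists s : seq G, forall x : G,
    exists2 w : seq G, {subset w <= s} & x = (\prod_(y <- w) y)%g.

(* Main.v *)
Require Import Defs.
From mathcomp Require Import all_boot all_order all_algebra.
From mathcomp Require Import perm zify.

(** For n <= 2 generators can be written down.  When n = 2, diagonal matrices
are generated by diag(1, 0), diag(-1, 0), diag(-oo, 0) and the swap; rescaling
rows and columns of one unitriangular matrix then gives all triangular ones,
and a matrix [a b; c d] with finite entries and a + d >= b + c is an upper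
triangular matrix times a lower triangular one ([fin_gen_dim2]).  If instead
a + d < b + c, swapping the two rows reverses the inequality.

For n >= 3 there are infinitely many unrelated irreducible matrices.  Take a
matrix A whose finite entries are exactly the (i, i) and (i, i + 1), indices
modulo n: its bipartite graph is a cycle of length 2n.  Such an A is prime: in
a factorization A = X Y one factor is monomial ([cyclic_support_prime]).  A
product of generators equal to A therefore contains a generator g with
A = u g v for monomial u and v.

To see that infinitely many g are needed, attach to a matrix the weights
sum_i A i (s i) of the permutations s for which all these entries are finite.
Multiplying by monomial matrices permutes the s and translates all weights by
a constant, so every difference of weights of A is one of g
([weight_gap_mull], [weight_gap_mulr]).  The generators, being finitely many,
realize finitely many differences altogether ([weight_gaps_list_finite]),
whereas [cycle_mx t] is a matrix of the above kind realizing an arbitrary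
integer t, as the weight of its diagonal minus that of its cyclic shift. *)

Set Implicit Arguments.
Unset Strict Implicit.
Unset Printing Implicit Defensive.

Import Order.TTheory GRing.Theory Num.Theory.
Local Open Scope ring_scope.

Local Notation fin a := (Some (a : int) : Zmax).

(** * Submonoids generated by a finite list *)

Definition generated (G : monoidType) (s : seq G) (x : G) : Prop :=
  exists2 w : seq G, {subset w <= s} & x = (\prod_(y <- w) y)%g.

Lemma generated_mem (G : monoidType) (s : seq G) (x : G) :
  x \in s -> generated s x.
Proof.
move=> xs; exists [:: x]; last by rewrite big_seq1.
by move=> y; rewrite inE => /eqP->.
Qed.

Lemma generated1 (G : monoidType) (s : seq G) : generated s 1%g.
Proof. by exists [::]; rewrite ?big_nil. Qed.

Lemma generatedM (G : monoidType) (s : seq G) (x y : G) :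
  generated s x -> generated s y -> generated s (x * y)%g.
Proof.
move=> [u us ->] [v vs ->]; exists (u ++ v); last by rewrite big_cat.
by move=> z; rewrite mem_cat => /orP[/us|/vs].
Qed.

(** Multiplicatively Zmax is generated by 1, -1 and -oo, so the same holds for
its image under any monoid morphism. *)
Lemma generated_Zmax (G : monoidType) (s : seq G) (f : Zmax -> G) :
  f 1 = 1%g -> (forall a b, f (a * b) = (f a * f b)%g) ->
  f (fin 1) \in s -> f (fin (-1)) \in s -> f 0 \in s ->
  forall a, generated s (f a).
Proof.
move=> f1 fM sp sn s0 [a|]; last exact: generated_mem.
elim: a => [|k IHk|k IHk]; first by rewrite f1; apply: generated1.
  have -> : fin k.+1%:Z = fin 1 * fin k%:Z.
    by congr Some; rewrite intS.
  by rewrite fM; apply: generatedM => //; apply: generated_mem.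
have -> : fin (- k.+1%:Z) = fin (-1) * fin (- k%:Z).
  by congr Some; rewrite intS opprD.
by rewrite fM; apply: generatedM => //; apply: generated_mem.
Qed.

(** * Dimensions one and two *)

Lemma fin_gen_dim1 : finitely_generated (MZmax 1).
Proof.
pose f (a : Zmax) : MZmax 1 := a%:M.
exists [:: f (fin 1); f (fin (-1)); f 0] => x.
have -> : x = f (x 0 0) by apply: mx11_scalar.
by apply: generated_Zmax; rewrite ?inE ?eqxx ?orbT // => a b; apply: scalar_mxM.
Qed.

Definition mx2 (a b c d : Zmax) : MZmax 2 :=
  \matrix_(i, j) if i == 0 then if j == 0 then a else b
                 else if j == 0 then c else d.

Arguments mx2 (a b c d)%_R.

Lemma mx2_eta (x : MZmax 2) : x = mx2 (x 0 0) (x 0 1) (x 1 0) (x 1 1).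
Proof.
apply/matrixP => i j; rewrite mxE.
by case: (unliftP 0 i) => [i'|] ->; case: (unliftP 0 j) => [j'|] -> //=;
   rewrite ?ord1 /=; congr (x _ _); apply: val_inj.
Qed.

Lemma mx2M a b c d a' b' c' d' :
  (mx2 a b c d * mx2 a' b' c' d')%g =
  mx2 (a * a' + b * c') (a * b' + b * d') (c * a' + d * c') (c * b' + d * d').
Proof.
apply/matrixP => i j; rewrite !mxE !big_ord_recl big_ord0 !mxE /= addr0.
by case: (i == 0); case: (j == 0).
Qed.

Lemma mx2_1 : mx2 1 0 0 1 = 1%g.
Proof.
apply/matrixP => i j; rewrite !mxE.
by case: (unliftP 0 i) => [i'|] ->; case: (unliftP 0 j) => [j'|] -> //=;
   rewrite ?ord1.
Qed.

(** The swap [P] lets rows and columns be exchanged, which reduces any matrix to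
an upper triangular one or to a finite one with [b + c <= a + d]. *)
Lemma fin_gen_dim2 : finitely_generated (MZmax 2).
Proof.
pose f (a : Zmax) : MZmax 2 := mx2 a 0 0 1.
pose P := mx2 0 1 1 0.
pose U := mx2 1 1 0 1.
exists [:: f (fin 1); f (fin (-1)); f 0; P; U].
set s := [:: _; _; _; _; _] => x; rewrite -/(generated s x).
have simp := (mx2M, mul0r, mulr0, mul1r, mulr1, add0r, addr0).
have gP : generated s P by apply: generated_mem; rewrite !inE eqxx !orbT.
have gU : generated s U by apply: generated_mem; rewrite !inE eqxx !orbT.
have gf a : generated s (f a).
  apply: generated_Zmax; rewrite ?inE ?eqxx ?orbT //; first exact: mx2_1.
  by move=> {}a b; rewrite /f !simp.
have gswap a b c d : generated s (mx2 c d a b) -> generated s (mx2 a b c d).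
  by move=> /(generatedM gP); rewrite /P !simp.
have grot a b c d : generated s (mx2 d c b a) -> generated s (mx2 a b c d).
  by move=> /gswap /generatedM /(_ gP); rewrite /P !simp.
have gdiag a d : generated s (mx2 a 0 0 d).
  have -> : mx2 a 0 0 d = (f a * mx2 1 0 0 d)%g by rewrite !simp.
  by apply: generatedM => //; apply: grot; apply: gf.
have gupper a b d : generated s (mx2 a b 0 d).
  case: b => [b|]; last exact: gdiag.
  (* Scaling rows and columns of U moves its finite off-diagonal entry to b. *)
  have -> : mx2 a (fin b) 0 d =
      (mx2 (fin b) 0 0 d * (U * mx2 (fin (- b) * a) 0 0 1))%g.
    by rewrite !simp mulrA; congr mx2; rewrite -[LHS]mul1r; congr (_ * _);
       congr Some; rewrite subrr.
  by do 2?apply: generatedM.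
have glower a c d : generated s (mx2 a 0 c d) by apply/grot/gupper.
have gpos (a b c d : int) : b + c <= a + d ->
    generated s (mx2 (fin a) (fin b) (fin c) (fin d)).
  move=> bcad.
  (* The top left entry of the product is max(a, b + (c - d)), which is a by
     the assumed inequality. *)
  have -> : mx2 (fin a) (fin b) (fin c) (fin d) =
      (mx2 1 (fin b) 0 (fin d) * mx2 (fin a) 0 (fin (c - d)) 1)%g.
    rewrite !simp; congr mx2; congr Some; last by rewrite addrC subrK.
    by apply/esym/max_idPl; lia.
  exact: generatedM.
rewrite (mx2_eta x).
case: (x 0 0) (x 0 1) (x 1 0) (x 1 1) => [a|] [b|] [c|] [d|];
  try by [apply: gupper | apply: glower
         | apply/gswap/gupper | apply/gswap/glower].
have [/gpos//|/ltW le] := leP (b + c) (a + d).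
by apply/gswap/gpos; rewrite addrC [c + b]addrC.
Qed.

(** * Monomial matrices and permutation weights *)

Lemma Zmax_mul_neq0 (a b : Zmax) : (a * b != 0) = (a != 0) && (b != 0).
Proof. by case: a b => [a|] [b|]. Qed.

(** No cancellation occurs in a tropical sum: supports of matrix products are
Boolean products of supports. *)
Lemma Zmax_sum_neq0 (I : finType) (F : I -> Zmax) :
  (\sum_i F i != 0) = [exists i, F i != 0].
Proof.
apply/idP/idP => [|/existsP[i Fi]]; last first.
  by rewrite (bigD1 i) //=; case: (F i) Fi => // a _; case: (\sum_(_ | _) _).
by apply: contraNT => /existsPn F0; rewrite big1 // => i _; apply/eqP/negPn.
Qed.

Definition monomial n (A : MZmax n) : Prop :=
  exists (s : 'S_n) (d : 'I_n -> int),
    forall i j, A i j = if j == s i then fin (d i) else 0.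

Lemma monomial_support n (A : MZmax n) (s : 'S_n) :
  (forall i j, (A i j != 0) = (j == s i)) -> monomial A.
Proof.
move=> As; exists s, (fun i => odflt 0 (A i (s i))) => i j.
have := As i j; case: (j =P s i) => [-> | _ /negbFE/eqP //].
by case: (A _ _).
Qed.

Definition perm_weight n (A : MZmax n) (s : 'S_n) : Zmax := \prod_i A i (s i).

Lemma Zmax_prod_fin (I : finType) (d : I -> int) :
  \prod_i (fin (d i)) = fin (\sum_i d i).
Proof. by elim/big_rec2: _ => // i x y _ ->. Qed.

(** Only differences of weights are kept, because multiplication by a monomial
matrix adds the same integer to all the weights. *)
Definition weight_gap n (A : MZmax n) (t : int) : Prop :=
  exists (s s' : 'S_n) (a b : int),
    [/\ perm_weight A s = fin a, perm_weight A s' = fin b & a - b = t].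

Lemma weight_gap_shift n (A B : MZmax n) (f : 'S_n -> 'S_n) (c : int) t :
  (forall s, perm_weight B s = fin c * perm_weight A (f s)) ->
  weight_gap B t -> weight_gap A t.
Proof.
move=> BA [s] [s'] [a] [b] []; rewrite !BA => wa wb <-; exists (f s), (f s').
case: (perm_weight A (f s)) wa => // a' [<-].
case: (perm_weight A (f s')) wb => // b' [<-].
by exists a', b'; split=> //; rewrite opprD addrACA subrr add0r.
Qed.

(** If the support of u is the permutation s, row i of u A is row s i of A
shifted by d i; so the weight of r in u A is that of s^-1 r in A, plus the sum
of the d i. *)
Lemma weight_gap_mull n (u A : MZmax n) t :
  monomial u -> weight_gap (u * A)%g t -> weight_gap A t.
Proof.
move=> [s] [d] us; apply: (weight_gap_shift (f := fun r => (s^-1 * r)%g)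
  (c := \sum_i d i)) => r.
rewrite /perm_weight -Zmax_prod_fin [in X in _ * X](reindex_perm s) /=.
rewrite -big_split /=; apply: eq_bigr => i _.
rewrite mxE (bigD1 (s i)) //= us eqxx permM permK big1 ?addr0 // => j ne.
by rewrite us (negPf ne) mul0r.
Qed.

Lemma weight_gap_mulr n (A v : MZmax n) t :
  monomial v -> weight_gap (A * v)%g t -> weight_gap A t.
Proof.
move=> [s] [d] vs; apply: (weight_gap_shift (f := fun r => (r * s^-1)%g)
  (c := \sum_i d i)) => r.
rewrite /perm_weight -Zmax_prod_fin.
rewrite [in X in X * _](reindex_perm (r * s^-1)%g) /=.
rewrite -big_split /=; apply: eq_bigr => i _.
rewrite mxE (bigD1 ((r * s^-1)%g i)) //= vs permM permKV eqxx mulrC.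
rewrite big1 ?addr0 // => j ne.
by rewrite vs -(can2_eq (permKV s) (permK s)) eq_sym (negPf ne) mulr0.
Qed.

Lemma weight_gaps_finite n (A : MZmax n) :
  exists l : seq int, forall t, weight_gap A t -> t \in l.
Proof.
pose w s := odflt 0 (perm_weight A s).
exists [seq w p.1 - w p.2 | p : 'S_n * 'S_n].
move=> t [s] [s'] [a] [b] [wa wb <-]; apply/imageP; exists (s, s') => //=.
by rewrite /w wa wb.
Qed.

Lemma weight_gaps_list_finite n (l : seq (MZmax n)) :
  exists L : seq int, forall A t, A \in l -> weight_gap A t -> t \in L.
Proof.
elim: l => [|A l [L HL]]; first by exists [::].
have [L' HL'] := weight_gaps_finite A; exists (L' ++ L) => B t.
rewrite inE mem_cat => /orP[/eqP->/HL'->//|Bl /(HL _ _ Bl)->].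
by rewrite orbT.
Qed.

(** * Prime matrices supported on a cycle *)

Section Cycle.

Variable m : nat.
Local Notation n := m.+3.

Definition cyclic_support (A : MZmax n) : Prop :=
  forall i j : 'I_n, (A i j != 0) = (j == i) || (j == i + 1).

Lemma step_neq (i : 'I_n) : (i + 1 == i) = false.
Proof. by rewrite -[X in _ == X]addr0 (inj_eq (addrI i)). Qed.

Lemma two_steps_neq (i : 'I_n) : (i + 1 + 1 == i) = false.
Proof. by rewrite -addrA -[X in _ == X]addr0 (inj_eq (addrI i)). Qed.

(** Going round the cycle from any starting point reaches every index. *)
Lemma cycle_ind (T : 'I_n -> Prop) i :
  T i -> (forall j, T j -> T (j + 1)) -> forall j, T j.
Proof.
move=> Ti TS j.
have Tk k : T (i + k%:R).
  elim: k => [|k IHk]; first by rewrite addr0.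
  by rewrite mulrSr addrA; apply: TS.
by have := Tk (nat_of_ord (j - i)); rewrite natr_Zp addrC subrK.
Qed.

(** View the support of X Y as a cycle covered by the n bicliques
(column k of X) x (row k of Y).  No biclique contains two diagonal edges (i, i)
and (j, j): it would also contain (i, j) and (j, i), making i and j successors
of each other, which is impossible when n >= 3.  The same holds for the edges
(i, i + 1).  With n bicliques for n edges of each kind, every biclique contains
exactly one of each kind, and these two edges share a row or a column.  If one
biclique [p i] is a row star, then so is the next one, since the off-diagonal
edge (i, i + 1) is already used; so all bicliques are row stars, and X is
monomial, or all are column stars, and Y is monomial. *)
Lemma cyclic_support_prime (X Y : MZmax n) :
  cyclic_support (X * Y)%g -> monomial X \/ monomial Y.
Proof.
move=> XY.
have edge (i j k : 'I_n) : X i k != 0 -> Y k j != 0 -> (j == i) || (j == i + 1).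
  move=> Xik Ykj; rewrite -XY mxE Zmax_sum_neq0.
  by apply/existsP; exists k; rewrite Zmax_mul_neq0 Xik.
have cover (i j : 'I_n) : (j == i) || (j == i + 1) ->
    {k | (X i k != 0) && (Y k j != 0)}.
  move=> ij; apply: sigW; move: ij; rewrite -XY mxE Zmax_sum_neq0.
  by move=> /existsP[k]; rewrite Zmax_mul_neq0; exists k.
have diag (i : 'I_n) : (i == i) || (i == i + 1) by rewrite eqxx.
have off (i : 'I_n) : (i + 1 == i) || (i + 1 == i + 1) by rewrite eqxx orbT.
pose p (i : 'I_n) := sval (cover i i (diag i)).
pose q (i : 'I_n) := sval (cover i (i + 1) (off i)).
have Xp i : X i (p i) != 0 by rewrite /p; case: (cover _ _ _) => k /= /andP[].
have Yp i : Y (p i) i != 0 by rewrite /p; case: (cover _ _ _) => k /= /andP[].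
have Xq i : X i (q i) != 0 by rewrite /q; case: (cover _ _ _) => k /= /andP[].
have Yq i : Y (q i) (i + 1) != 0.
  by rewrite /q; case: (cover _ _ _) => k /= /andP[].
have p_inj : injective p.
  move=> i j pij.
  have := edge i j (p i) (Xp i); rewrite pij => /(_ (Yp j)).
  have := edge j i (p j) (Xp j); rewrite -pij => /(_ (Yp i)).
  case/orP=> /eqP-> //.
  by rewrite eq_sym step_neq eq_sym two_steps_neq.
have q_inj : injective q.
  move=> i j qij.
  have := edge i (j + 1) (q i) (Xq i); rewrite qij => /(_ (Yq j)).
  have := edge j (i + 1) (q j) (Xq j); rewrite -qij => /(_ (Yq i)).
  rewrite !(inj_eq (addIr _)).
  case/orP=> /eqP e // /orP[/eqP e'|/eqP->//].
  by have := two_steps_neq i; rewrite e e' eqxx.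
pose s := perm p_inj; have sE i : s i = p i by rewrite permE.
(* Being injective on a finite type, q is onto, so p i = q i' for some i'; the
   biclique then contains (i, i' + 1), which leaves i' = i or i' + 1 = i. *)
have row_or_col i : (q i = p i) \/ (q (i - 1) = p i).
  have [q' qK q'K] := injF_bij q_inj.
  have qq : q (q' (p i)) = p i by rewrite q'K.
  set i' := q' (p i) in qq.
  have := Yq i'; rewrite qq => /(edge _ _ _ (Xp i)) /orP[/eqP e|/eqP e].
    by right; rewrite -qq -{1}e addrK.
  by left; rewrite -{1}(addIr _ e).
have rowS i : q i = p i -> q (i + 1) = p (i + 1).
  move=> qi; case: (row_or_col (i + 1)) => //; rewrite addrK qi.
  by move=> /p_inj /esym/eqP; rewrite step_neq.
have [/existsP[i0 /eqP Ti0] | none] := boolP [exists i, q i == p i].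
  left; apply: (@monomial_support _ _ s) => i k; rewrite sE.
  apply/idP/eqP => [Xik | ->]; last exact: Xp.
  have row := cycle_ind Ti0 rowS.
  rewrite -(permKV s k) sE; congr p; move: Xik; rewrite -{1}(permKV s k) sE.
  set j := (s^-1)%g k => Xij.
  have := Yq j; rewrite row => /(edge _ _ _ Xij).
  have := edge _ _ _ Xij (Yp j).
  case/orP=> /eqP-> //.
  by rewrite two_steps_neq (inj_eq (addIr _)) step_neq.
right; apply: (@monomial_support _ _ (s^-1)%g) => k j.
rewrite -(can2_eq (permK s) (permKV s)) sE.
apply/idP/eqP => [Ykj | <-]; last exact: Yp.
have col i : q (i - 1) = p i.
  case: (row_or_col i) => // /eqP qi.
  by case/negP: none; apply/existsP; exists i.
rewrite -(permKV s k) sE; congr p; move: Ykj; rewrite -{1}(permKV s k) sE.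
set i := (s^-1)%g k => Yij.
have := edge _ _ _ (Xp i) Yij.
have := Xq (i - 1); rewrite col => /edge /(_ Yij); rewrite subrK.
case/orP=> /eqP-> //.
have := two_steps_neq (i - 1); rewrite subrK eq_sym => ->.
by have := step_neq (i - 1); rewrite subrK eq_sym => ->.
Qed.

Lemma monomial_not_cyclic (A : MZmax n) :
  monomial A -> cyclic_support A -> False.
Proof.
move=> [s] [d] As Ac.
have sE (j : 'I_n) : (j == 0) || (j == 0 + 1) -> j = s 0.
  by rewrite -Ac As; case: (j =P s 0).
have /sE e1 : (0 + 1 == 0 :> 'I_n) || (0 + 1 == 0 + 1 :> 'I_n).
  by rewrite eqxx orbT.
by have := step_neq 0; rewrite e1 -(sE 0) ?eqxx.
Qed.

(** Some factor g of A satisfies A = u g v with u and v monomial: read the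
product from the left, absorbing factors into u as long as the prefix stays monomial;
by primality, the first time it does not, the rest of the product is
monomial. *)
Lemma cyclic_weight_gap_factor (w : seq (MZmax n)) (A : MZmax n) t :
  cyclic_support A -> weight_gap A t -> A = (\prod_(y <- w) y)%g ->
  exists2 g, g \in w & weight_gap g t.
Proof.
move=> Ac At Aw.
have : exists2 u, monomial u & A = (u * \prod_(y <- w) y)%g.
  exists 1%g; last by rewrite mul1g.
  exists 1%g, (fun=> 0) => i j; rewrite mxE perm1 eq_sym.
  by case: eqP.
elim: w {Aw} => [|g w IHw] [u um Au].
  by case: (@monomial_not_cyclic A) => //; rewrite Au big_nil mulg1.
rewrite big_cons in Au.
have := Ac; rewrite {1}Au mulgA => /cyclic_support_prime[ugm | vm].
  have [|h hw ht] := IHw; first by exists (u * g)%g; rewrite ?Au ?mulgA.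
  by exists h; rewrite // inE hw orbT.
exists g; first by rewrite inE eqxx.
by move: At; rewrite Au => /(weight_gap_mull um) /(weight_gap_mulr vm).
Qed.

Definition cycle_mx (t : int) : MZmax n :=
  \matrix_(i, j) if j == i then fin (if i == 0 then t else 0)
                 else if j == i + 1 then fin 0 else None.

Lemma cycle_mx_support t : cyclic_support (cycle_mx t).
Proof. by move=> i j; rewrite mxE; case: (j == i) => //; case: (j == _). Qed.

Lemma cycle_mx_gap t : weight_gap (cycle_mx t) t.
Proof.
exists 1%g, (perm (addIr (1 : 'I_n))), t, 0; split; last by rewrite subr0.
  rewrite /perm_weight (eq_bigr (fun i => fin (if i == 0 then t else 0))).
    by rewrite Zmax_prod_fin -big_mkcond big_pred1_eq.
  by move=> i _; rewrite mxE perm1 eqxx.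
rewrite /perm_weight (eq_bigr (fun=> 1)) ?big1_eq // => i _.
by rewrite mxE permE step_neq eqxx.
Qed.

Lemma not_fin_gen_dim3 : ~ finitely_generated (MZmax n).
Proof.
move=> [s sP]; have [L LP] := weight_gaps_list_finite s.
have inL t : t \in L.
  have [w ws wE] := sP (cycle_mx t).
  have [g gw gt] := cyclic_weight_gap_factor (@cycle_mx_support t)
    (cycle_mx_gap t) wE.
  exact: LP (ws _ gw) gt.
pose N := [seq Posz k | k <- iota 0 (size L).+1].
have : (size N <= size L)%N.
  apply: uniq_leq_size => [|t _ //].
  by rewrite map_inj_uniq ?iota_uniq // => a b [].
by rewrite size_map size_iota ltnn.
Qed.

End Cycle.

Theorem corollary4p7 (n : nat) (hn : (0 < n)%N) :
  finitely_generated (MZmax n) <-> (n <= 2)%N.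
Proof.
case: n hn => [|[|[|m]]] // _; split=> // fg.
- exact: fin_gen_dim1.
- exact: fin_gen_dim2.
- by case: (not_fin_gen_dim3 fg).
Qed.
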